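(* Let $f \in L(Y^o)$, $g_1 \in L(\partial Y)$ and $g_2 \in L(\partial X)$, where $Y=X^o$. If the matrix $I_{\partial Y} + R_{[Y]}$ is invertible -- in particular, if $P$ is reversible -- the problem to find $u \in L(X)$ such that $$\Delta_{[Y]}^2 u = f \ \text{ on } Y^o,\quad \partial_{\vec n}^*u = g_1\ \text{ on }\partial Y \quad\text{and}\quad u = g_2\ \text{ on }\partial X$$ has a unique solution (here $\Delta_{[Y]}$ is applied to the restriction of $u$ to $Y$). On $Y$, it is the (unique) solution of the bi-Laplace Dirichlet problem $$\Delta_{[Y]}^2 u = f \ \text{ on } Y^o,\quad u = g\ \text{ on }\partial Y,\quad\text{where}\quad g(y) = \frac{1}{p(y,\partial X)}\sum_{z \in \partial X} p(y,z)g_2(z) - g_1(y),\quad y \in \partial Y,$$ which is given on $Y^o$ by $u|_{Y^o}=S_{[Y]}^{-1}(f+U_{[Y]}\,g)$.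
   Context: Let $(X,E)$ be a finite directed graph, $E\subset X^2$ without loops, which is strongly connected. Each edge $(x,y)\in E$ carries a weight $a(x,y)>0$, and $a(x,y)=0$ if $(x,y)\notin E$. Put $m(x)=\sum_y a(x,y)$, $p(x,y)=a(x,y)/m(x)$, $P=(p(x,y))_{x,y\in X}$, and $p(x,A)=\sum_{y\in A}p(x,y)$. $L(B)$ is the space of functions $B\to\mathbb{C}$ (column vectors). $\pi$ denotes the unique stationary probability distribution of $P$; $P$ is reversible if $\pi(x)p(x,y)=\pi(y)p(y,x)$ for all $x,y\in X$. The boundary $\partial X$ is a non-empty subset of $X$, and $X^o=X\setminus\partial X$. Let $Y=X^o$, and assume that $|Y|\ge2$ and that the induced directed subgraph on $Y$ is strongly connected. Put $\partial Y=\{x\in Y:(x,z)\in E\text{ for some }z\in X\setminus Y\}$ and $Y^o=Y\setminus\partial Y$. The transition matrix of $Y$ as a network in its own right is $P_{[Y]}=(p_{[Y]}(x,y))_{x,y\in Y}$ with $p_{[Y]}(x,y)=a(x,y)/m_{[Y]}(x)$, $m_{[Y]}(x)=\sum_{w\in Y}a(x,w)$, and $\Delta_{[Y]}=P_{[Y]}-I_Y$ acts on $L(Y)$. For $u\in L(X)$ and $y\in\partial Y$, $$\partial_{\vec n}^*u(y)=\frac1{p(y,X\setminus Y)}\sum_{z\in X\setminus Y}p(y,z)\bigl(u(z)-u(y)\bigr).$$ Write $P_{[Y];A,B}=(p_{[Y]}(x,y))_{x\in A,y\in B}$ and $P_{[Y];A}=P_{[Y];A,A}$ for $A,B\subset Y$,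 and $G_{Y^o}=(I_{Y^o}-P_{[Y];Y^o})^{-1}$ (the inverse exists). Then $$R_{[Y]}=P_{[Y];\partial Y,Y^o}\,G_{Y^o}^{\,2}\,P_{[Y];Y^o,\partial Y}$$ (a matrix over $\partial Y$), $$S_{[Y]}=(I_{Y^o}-P_{[Y];Y^o})^2+P_{[Y];Y^o,\partial Y}P_{[Y];\partial Y,Y^o},$$ $$U_{[Y]}=(I_{Y^o}-P_{[Y];Y^o})P_{[Y];Y^o,\partial Y}+P_{[Y];Y^o,\partial Y}(I_{\partial Y}-P_{[Y];\partial Y}).$$ The matrix $S_{[Y]}$ is invertible if and only if $I_{\partial Y}+R_{[Y]}$ is. *)

(* Defs.v *)
From HB Require Import structures.
From mathcomp Require Import all_boot all_order all_algebra.
From mathcomp Require Import reals complex.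

Set Implicit Arguments.
Unset Strict Implicit.
Unset Printing Implicit Defensive.

Import Order.TTheory GRing.Theory Num.Theory.
Local Open Scope ring_scope.
Local Open Scope complex_scope.

(* L(B), the complex functions on B as column vectors: the coordinates of B   *)
(* are indexed by its enumeration [enum_val : 'I_#|B| -> X].                  *)
Notation fun_on R B := 'cV[R[i]]_#|B|.

Section Functions.
Variables (R : realType) (X : finType).
Implicit Types A B : {set X}.

(* The value of v at x for x \in B, and 0 for x \notin B. *)
Definition val_at B (v : fun_on R B) (x : X) : R[i] :=
  \sum_(i < #|B| | enum_val i == x) v i 0.

Lemma val_at_enum_val B (v : fun_on R B) (i : 'I_#|B|) :
  val_at v (enum_val i) = v i 0.
Proof.
rewrite /val_at (big_pred1 i) // => j.
by rewrite (inj_eq enum_val_inj).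
Qed.

(* Only meaningful for A \subset B. *)
Definition restr_to B A (v : fun_on R B) : fun_on R A :=
  \col_i val_at v (enum_val i).

End Functions.

Section Network.
Variables (R : realType) (X : finType) (E : rel X) (a : X -> X -> R).
Implicit Types Y A B : {set X}.

Definition strongly_connected : Prop := forall x y, connect E x y.

Definition induced_strongly_connected Y : Prop :=
  {in Y &, forall x y,
    connect [rel z w | [&& z \in Y, w \in Y & E z w]] x y}.

Definition weight (x : X) : R := \sum_y a x y.

Definition trans (x y : X) : R := a x y / weight x.

Definition trans_set (x : X) A : R := \sum_(y in A) trans x y.

Definition stationary_distribution (pi : X -> R) : Prop :=
  [/\ forall x, 0 <= pi x,
      \sum_x pi x = 1 &
      forall y, \sum_x pi x * trans x y = pi y].

(* On a strongly connected network the stationary distribution is unique, so  *)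
(* the existential quantifier refers to that distribution.                    *)
Definition reversible : Prop :=
  exists2 pi : X -> R, stationary_distribution pi &
    forall x y, pi x * trans x y = pi y * trans y x.

(* The boundary of Y as a subnetwork: vertices of Y with an edge leaving Y. *)
Definition net_boundary Y : {set X} :=
  [set x in Y | [exists z, (z \notin Y) && E x z]].

Definition net_interior Y : {set X} := Y :\: net_boundary Y.

Definition sub_weight Y (x : X) : R := \sum_(w in Y) a x w.

Definition sub_trans Y (x y : X) : R := a x y / sub_weight Y x.

(* The block P_{[Y];A,B}, for A, B \subset Y, with complex entries. *)
Definition sub_block Y A B : 'M[R[i]]_(#|A|, #|B|) :=
  \matrix_(i, j) (sub_trans Y (enum_val i) (enum_val j))%:C.

Definition sub_laplacian Y : 'M[R[i]]_#|Y| := sub_block Y Y Y - 1%:M.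

(* The derivative \partial_n^* of u on the boundary of Y. *)
Definition conormal Y (u : fun_on R [set: X]) : fun_on R (net_boundary Y) :=
  \col_i (let y := enum_val i in
    ((trans_set y (~: Y))%:C)^-1 *
    \sum_(z in ~: Y) (trans y z)%:C * (val_at u z - val_at u y)).

(* [invmx M] is M when M is singular; the matrix inverted here is invertible  *)
(* as soon as the boundary of Y can be reached within Y from every vertex of  *)
(* its interior.                                                              *)
Definition green Y : 'M[R[i]]_#|net_interior Y| :=
  invmx (1%:M - sub_block Y (net_interior Y) (net_interior Y)).

Definition Rmx Y : 'M[R[i]]_#|net_boundary Y| :=
  sub_block Y (net_boundary Y) (net_interior Y) *m (green Y *m green Y)
    *m sub_block Y (net_interior Y) (net_boundary Y).

Definition Smx Y : 'M[R[i]]_#|net_interior Y| :=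
  (1%:M - sub_block Y (net_interior Y) (net_interior Y))
    *m (1%:M - sub_block Y (net_interior Y) (net_interior Y))
  + sub_block Y (net_interior Y) (net_boundary Y)
    *m sub_block Y (net_boundary Y) (net_interior Y).

Definition Umx Y : 'M[R[i]]_(#|net_interior Y|, #|net_boundary Y|) :=
  (1%:M - sub_block Y (net_interior Y) (net_interior Y))
    *m sub_block Y (net_interior Y) (net_boundary Y)
  + sub_block Y (net_interior Y) (net_boundary Y)
    *m (1%:M - sub_block Y (net_boundary Y) (net_boundary Y)).

Definition sub_bilaplacian Y (v : fun_on R Y) : fun_on R Y :=
  sub_laplacian Y *m (sub_laplacian Y *m v).

Definition dirichlet_problem Y (f : fun_on R (net_interior Y))
    (g : fun_on R (net_boundary Y)) (v : fun_on R Y) : Prop :=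
  restr_to (net_interior Y) (sub_bilaplacian v) = f /\
  restr_to (net_boundary Y) v = g.

Definition mixed_problem (dX : {set X}) (f : fun_on R (net_interior (~: dX)))
    (g1 : fun_on R (net_boundary (~: dX))) (g2 : fun_on R dX)
    (u : fun_on R [set: X]) : Prop :=
  [/\ restr_to (net_interior (~: dX))
        (sub_bilaplacian (restr_to (~: dX) u)) = f,
      conormal (~: dX) u = g1 &
      restr_to dX u = g2].

Definition dirichlet_data (dX : {set X}) (g1 : fun_on R (net_boundary (~: dX)))
    (g2 : fun_on R dX) : fun_on R (net_boundary (~: dX)) :=
  \col_i (let y := enum_val i in
    ((trans_set y dX)%:C)^-1 * (\sum_(z in dX) (trans y z)%:C * val_at g2 z)
    - val_at g1 y).

End Network.

(* Main.v *)
Require Import Defs.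
From HB Require Import structures.
From mathcomp Require Import all_boot all_order all_algebra.
From mathcomp Require Import reals complex.

Import Order.TTheory GRing.Theory Num.Theory.
Local Open Scope ring_scope.
Local Open Scope complex_scope.

(** Write Y for the complement of dX, cut into its boundary and its interior.
On the boundary of Y the vertices have a positive probability to move to dX, so
prescribing the conormal derivative g1, once u = g2 on dX, amounts to prescribing
u = g there ([conormalE]): the mixed problem is a Dirichlet problem on Y
together with free data on dX ([mixed_problemE]).

In blocks, with P, C, B, D the parts of the transition matrix of Y that go from
interior to interior, interior to boundary, boundary to interior and boundary to
boundary, the bi-Laplacian of v on the interior is S v_int - U v_bd
([restr_bilaplacian]), so the Dirichlet problem amounts to S v_int = f + U g and
everything depends on the invertibility of S = (1 - P)^2 + C B.

The matrix 1 - P is invertible by the maximum principle: a function that is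
harmonic on the interior and zero on the boundary is zero, because a nonzero
extremum spreads along edges until it meets the boundary ([interior_unitmx]). Then S
inherits invertibility from 1 + R, with R = B (1 - P)^-2 C ([schur_unitmx]).

If the walk is reversible, so is the walk on Y, for a positive measure mu; then
B is the adjoint of C and 1 - P is self-adjoint for the Hermitian forms weighted
by mu. Hence <v, R v> = <w, w> with w = (1 - P)^-1 C v, which is nonnegative, and
(1 + R) v = 0 forces <v, v> = 0 ([Rmx_unit]). *)

(** * Reachability and linear algebra *)

Lemma connect_closed (T : finType) (e : rel T) (P : pred T) x y :
  connect e x y -> P x -> (forall z w, P z -> e z w -> P w) -> P y.
Proof.
move=> /connectP [p pth ->] Px Pe.
by elim: p x Px pth => //= z p IHp x Px /andP [/(Pe _ _ Px)]; apply: IHp.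
Qed.

Section Matrices.
Variable F : fieldType.

Lemma unitmx_ker n (M : 'M[F]_n) :
  (forall v : 'cV_n, M *m v = 0 -> v = 0) -> M \in unitmx.
Proof.
move=> Minj; rewrite -unitmx_tr -row_free_unit; apply: inj_row_free => v vM.
apply: trmx_inj; rewrite trmx0; apply: Minj.
by rewrite -[M]trmxK -trmx_mul vM trmx0.
Qed.

(** If (A^2 + C B) v = 0, then v = - A^-2 C q for q = B v, so q lies in the kernel
of 1 + B A^-2 C. *)
Lemma schur_unitmx n k (A : 'M[F]_n) (B : 'M[F]_(k, n)) (C : 'M[F]_(n, k)) :
  A \in unitmx -> 1%:M + B *m (invmx A *m invmx A) *m C \in unitmx ->
  A *m A + C *m B \in unitmx.
Proof.
move=> uA uR; apply: unitmx_ker => v.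
rewrite mulmxDl -!mulmxA => /eqP; rewrite addr_eq0 => /eqP AAv.
have vE : v = - (invmx A *m (invmx A *m (C *m (B *m v)))).
  by rewrite -[LHS](mulKmx uA) -[A *m v](mulKmx uA) AAv !mulmxN.
suff Bv : B *m v = 0 by rewrite vE Bv !mulmx0 oppr0.
rewrite -[LHS](mulKmx uR) mulmxDl mul1mx -!mulmxA {1}vE mulmxN addNr.
exact: mulmx0.
Qed.

(** The Laplacian sends the pair (v, w) of interior and boundary values to
(v1, w1); the identity computes the interior part of its square. *)
Lemma bilaplace_block n k (P : 'M[F]_n) (C : 'M[F]_(n, k)) (B : 'M[F]_(k, n))
    (D : 'M[F]_k) (v : 'cV[F]_n) (w : 'cV[F]_k) :
  let A := 1%:M - P in
  let v1 := (P *m v + C *m w) - v in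
  let w1 := (B *m v + D *m w) - w in
  (P *m v1 + C *m w1) - v1 =
    (A *m A + C *m B) *m v - (A *m C + C *m (1%:M - D)) *m w.
Proof.
move=> A v1 w1.
have PE (x : 'cV_n) : P *m x = x - A *m x.
  by rewrite mulmxBl mul1mx opprB addrC subrK.
have v1E : v1 = C *m w - A *m v.
  by rewrite /v1 PE addrAC [v - _]addrC addrK addrC.
have w1E : w1 = B *m v - (1%:M - D) *m w.
  by rewrite mulmxBl mul1mx opprB addrA.
rewrite PE addrAC [v1 - _]addrC addrK v1E w1E.
move: A (1%:M - D) {PE v1 w1 v1E w1E} => A D'.
by rewrite !mulmxBr !mulmxDl !mulmxA opprB opprD addrACA.
Qed.

End Matrices.

(** * Functions on subsets of the vertices *)

Section Functions.
Context {R : realType} {X : finType}.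
Implicit Types A B C : {set X}.

Lemma val_at_in {B} (v : fun_on R B) x (xB : x \in B) :
  val_at v x = v (enum_rank_in xB x) 0.
Proof. by rewrite -val_at_enum_val enum_rankK_in. Qed.

Lemma val_at_out {B} (v : fun_on R B) x : x \notin B -> val_at v x = 0.
Proof.
by move=> xB; apply: big1 => i /eqP ix; rewrite -ix enum_valP in xB.
Qed.

Lemma val_at_inj {B} (v w : fun_on R B) :
  {in B, val_at v =1 val_at w} -> v = w.
Proof.
move=> vw; apply/colP => i; rewrite -!val_at_enum_val; apply: vw.
exact: enum_valP.
Qed.

Lemma val_at_col {B} (h : X -> R[i]) :
  {in B, val_at (\col_(i < #|B|) h (enum_val i)) =1 h}.
Proof. by move=> x xB; rewrite (val_at_in _ _ xB) mxE enum_rankK_in. Qed.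

Lemma val_at_restr {A B} (v : fun_on R B) :
  {in A, val_at (restr_to A v) =1 val_at v}.
Proof. exact: val_at_col. Qed.

Lemma val_at0 {B} x : val_at (0 : fun_on R B) x = 0.
Proof. by apply: big1 => i _; rewrite mxE. Qed.

Lemma val_atD {B} (v w : fun_on R B) x :
  val_at (v + w) x = val_at v x + val_at w x.
Proof. by rewrite -big_split; apply: eq_bigr => i _; rewrite mxE. Qed.

Lemma val_atN {B} (v : fun_on R B) x : val_at (- v) x = - val_at v x.
Proof. by rewrite -sumrN; apply: eq_bigr => i _; rewrite mxE. Qed.

Lemma restrB {A B} (v w : fun_on R B) :
  restr_to A (v - w) = restr_to A v - restr_to A w.
Proof. by apply/colP => i; rewrite !mxE val_atD val_atN. Qed.

(** Values off the domain are zero, so for disjoint A and B the sum is v on A and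
w on B. *)
Definition glue {A B} C (v : fun_on R A) (w : fun_on R B) : fun_on R C :=
  \col_i (val_at v (enum_val i) + val_at w (enum_val i)).

Lemma restr_gluel {A B C} (v : fun_on R A) (w : fun_on R B) :
  A \subset C -> [disjoint A & B] -> restr_to A (glue C v w) = v.
Proof.
move=> AC AB; apply: val_at_inj => x xA; rewrite val_at_restr //.
rewrite (val_at_col (fun y => val_at v y + val_at w y)); last exact: (subsetP AC).
by rewrite [val_at w x]val_at_out ?addr0 // (disjointFr AB xA).
Qed.

Lemma restr_gluer {A B C} (v : fun_on R A) (w : fun_on R B) :
  B \subset C -> [disjoint A & B] -> restr_to B (glue C v w) = w.
Proof.
move=> BC AB; apply: val_at_inj => x xB; rewrite val_at_restr //.
rewrite (val_at_col (fun y => val_at v y + val_at w y)); last exact: (subsetP BC).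
by rewrite [val_at v x]val_at_out ?add0r // (disjointFl AB xB).
Qed.

Lemma restr_inj {A B C} (v w : fun_on R C) : C \subset A :|: B ->
  restr_to A v = restr_to A w -> restr_to B v = restr_to B w -> v = w.
Proof.
move=> CAB vwA vwB; apply: val_at_inj => x /(subsetP CAB).
rewrite inE => /orP [xA | xB].
  by rewrite -(val_at_restr v x xA) vwA val_at_restr.
by rewrite -(val_at_restr v x xB) vwB val_at_restr.
Qed.

Lemma val_at_mul (a : X -> X -> R) Y {A B} (v : fun_on R B) :
  {in A, forall x, val_at (sub_block a Y A B *m v) x =
    \sum_(y in B) (sub_trans a Y x y)%:C * val_at v y}.
Proof.
move=> x xA; rewrite (val_at_in _ _ xA) mxE [RHS]big_enum_val /=.
by apply: eq_bigr => j _; rewrite mxE enum_rankK_in // val_at_enum_val.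
Qed.

End Functions.

(** * Transition probabilities *)

Section Weights.
Context {R : realType} {X : finType} {E : rel X} {a : X -> X -> R}.
Hypothesis a_pos : forall x y, E x y -> 0 < a x y.
Hypothesis a_zero : forall x y, ~~ E x y -> a x y = 0.

Lemma a_ge0 x y : 0 <= a x y.
Proof. by case: (boolP (E x y)) => [/a_pos/ltW //|/a_zero ->]. Qed.

Lemma trans_ge0 x y : 0 <= trans a x y.
Proof. by rewrite divr_ge0 ?sumr_ge0 // => *; apply: a_ge0. Qed.

Lemma trans_gt0 x y : E x y -> 0 < trans a x y.
Proof.
move=> xy; rewrite divr_gt0 ?a_pos // /weight (bigD1 y) //= ltr_wpDr ?a_pos //.
by apply: sumr_ge0 => *; apply: a_ge0.
Qed.

Lemma stationary_gt0 (pi : X -> R) :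
  strongly_connected E -> stationary_distribution a pi -> forall x, 0 < pi x.
Proof.
move=> E_connected [pi_ge0 pi1 piP] x.
have /existsP [y y_gt0] : [exists y, 0 < pi y].
  apply/existsP/existsP; apply: contraT; rewrite negb_exists => /forallP pi0.
  have /eqP := pi1; rewrite big1 => [|y _]; first by rewrite eq_sym oner_eq0.
  by apply/eqP; move: (pi0 y); rewrite lt0r pi_ge0 andbT negbK.
apply: (@connect_closed _ _ [pred z | 0 < pi z] _ _ (E_connected y x) y_gt0).
move=> z w /= z_gt0 zw; rewrite -piP (bigD1 z) //= ltr_wpDr //.
  by apply: sumr_ge0 => t _; rewrite mulr_ge0 // trans_ge0.
by rewrite mulr_gt0 // trans_gt0.
Qed.

End Weights.

(** * The bi-Laplacian in blocks *)

Section Network.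
Context {R : realType} {X : finType} {E : rel X} {a : X -> X -> R}.
Context {Y : {set X}}.
Hypothesis a_pos : forall x y, E x y -> 0 < a x y.
Hypothesis a_zero : forall x y, ~~ E x y -> a x y = 0.
Hypothesis Y_connected : induced_strongly_connected E Y.

Local Notation bY := (net_boundary E Y).
Local Notation iY := (net_interior E Y).
Local Notation p := (sub_trans a Y).
Local Notation PII := (sub_block a Y iY iY).
Local Notation PIB := (sub_block a Y iY bY).
Local Notation PBI := (sub_block a Y bY iY).

Lemma boundary_sub : bY \subset Y.
Proof. by apply/subsetP => x; rewrite inE => /andP []. Qed.

Lemma interior_sub : iY \subset Y.
Proof. exact: subsetDl. Qed.

Lemma interior_boundary_disjoint : [disjoint iY & bY].
Proof. by rewrite disjoints_subset /net_interior setDE subsetIr. Qed.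

Lemma interior_boundary_cover : Y \subset iY :|: bY.
Proof.
by apply/subsetP => x xY; rewrite !inE xY /=; case: [exists _, _].
Qed.

Lemma sum_network (h : X -> R[i]) :
  \sum_(x in Y) h x = \sum_(x in iY) h x + \sum_(x in bY) h x.
Proof.
by rewrite (big_setID bY) /= addrC (setIidPr boundary_sub).
Qed.

Lemma restr_block {A : {set X}} (v : fun_on R Y) : A \subset Y ->
  restr_to A (sub_block a Y Y Y *m v) =
    sub_block a Y A iY *m restr_to iY v + sub_block a Y A bY *m restr_to bY v.
Proof.
move=> AY; apply: val_at_inj => x xA.
rewrite val_at_restr // val_atD !val_at_mul //; last exact: (subsetP AY).
rewrite sum_network; congr (_ + _); apply: eq_bigr => y yB;
  by rewrite val_at_restr.
Qed.

Lemma restr_bilaplacian (v : fun_on R Y) :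
  restr_to iY (sub_bilaplacian a v) =
    Smx E a Y *m restr_to iY v - Umx E a Y *m restr_to bY v.
Proof.
rewrite /sub_bilaplacian /sub_laplacian !mulmxBl !mul1mx.
have step (A : {set X}) (w : fun_on R Y) : A \subset Y ->
    restr_to A (sub_block a Y Y Y *m w - w) =
    sub_block a Y A iY *m restr_to iY w + sub_block a Y A bY *m restr_to bY w
    - restr_to A w.
  by move=> AY; rewrite restrB restr_block.
rewrite step ?interior_sub // !step ?interior_sub ?boundary_sub //.
exact: bilaplace_block.
Qed.

Lemma dirichlet_problemE (f : fun_on R iY) (g : fun_on R bY) (v : fun_on R Y) :
  Smx E a Y \in unitmx ->
  dirichlet_problem a f g v <->
  restr_to iY v = invmx (Smx E a Y) *m (f + Umx E a Y *m g) /\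
  restr_to bY v = g.
Proof.
move=> uS; split=> [[fE gE]|[vE gE]]; split => //.
  by rewrite -fE restr_bilaplacian gE subrK mulKmx.
by rewrite restr_bilaplacian gE vE mulKVmx // addrK.
Qed.

(** * The maximum principle on the subnetwork *)

Hypothesis Y_card : (2 <= #|Y|)%N.

(** A second vertex of Y can be reached from x inside Y, so some edge of Y starts
at x. *)
Lemma sub_weight_gt0 x : x \in Y -> 0 < sub_weight a Y x.
Proof.
move=> xY; rewrite lt0r sumr_ge0 ?andbT => [|*]; last exact: (a_ge0 a_pos a_zero).
apply/negP => /eqP w0.
have /existsP [y /andP [yY yx]] : [exists y, (y \in Y) && (y != x)].
  apply: contraLR Y_card; rewrite negb_exists -leqNgt => /forallP yE.
  rewrite -(cards1 x); apply/subset_leq_card/subsetP => y yY.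
  by move: (yE y); rewrite yY /= negbK inE.
case/negP: yx; apply: (@connect_closed _ _ (pred1 x) _ _ (Y_connected _ _ xY yY)).
  exact: eqxx.
move=> z w /eqP -> /and3P [_ wY /a_pos].
by rewrite (psumr_eq0P _ w0) ?ltxx // => *; apply: (a_ge0 a_pos a_zero).
Qed.

Lemma sub_trans_ge0 x y : x \in Y -> 0 <= p x y.
Proof. by move=> xY; rewrite divr_ge0 ?(a_ge0 a_pos a_zero) // ltW ?sub_weight_gt0. Qed.

Lemma sub_trans_gt0 x y : x \in Y -> E x y -> 0 < p x y.
Proof. by move=> xY xy; rewrite divr_gt0 ?a_pos // sub_weight_gt0. Qed.

Lemma sub_trans_sum1 x : x \in Y -> \sum_(y in Y) p x y = 1.
Proof. by move=> xY; rewrite -mulr_suml divff // gt_eqF // sub_weight_gt0. Qed.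

Hypothesis boundary_n0 : bY != set0.

(** If the maximum of h on Y were positive it would be attained in the interior,
where it is an average over the neighbours; so all of them attain it, and along
a path the boundary would attain it as well. *)
Lemma maximum_principle (h : X -> R) :
  {in bY, forall x, h x = 0} ->
  {in iY, forall x, h x = \sum_(y in Y) p x y * h y} ->
  {in Y, forall x, h x <= 0}.
Proof.
move=> hB hI; case/set0Pn: boundary_n0 => b bB.
have bY' := subsetP boundary_sub _ bB.
case: (arg_maxP h bY') => m /(id : _ -> m \in Y) mY hmax.
suff m0 : h m <= 0 by move=> x xY; apply: le_trans m0; apply: hmax.
rewrite leNgt; apply/negP => hm0.
pose P := [pred x | (x \in Y) && (h x == h m)].
have : P b.
  apply: (@connect_closed _ _ P _ _ (Y_connected _ _ mY bY')).
    by rewrite /= mY eqxx.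
  move=> x y /= /andP [xY /eqP hx] /and3P [_ yY xy]; rewrite yY /=.
  have xI : x \in iY.
    rewrite in_setD xY andbT; apply: contraL hm0 => xB.
    by rewrite -hx hB // ltxx.
  have s0 : \sum_(z in Y) p x z * (h m - h z) = 0.
    under eq_bigr do rewrite mulrBr.
    by rewrite sumrB -mulr_suml sub_trans_sum1 // mul1r -hI // hx subrr.
  have := psumr_eq0P _ s0 yY => /(_ _)/eqP.
  rewrite mulf_eq0 gt_eqF ?sub_trans_gt0 //= subr_eq0 eq_sym; apply.
  by move=> z zY; rewrite mulr_ge0 ?sub_trans_ge0 // subr_ge0; apply: hmax.
by rewrite /= bY' hB // lt_eqF.
Qed.

Lemma harmonic_eq0 (h : X -> R) :
  {in bY, forall x, h x = 0} ->
  {in iY, forall x, h x = \sum_(y in Y) p x y * h y} ->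
  {in Y, forall x, h x = 0}.
Proof.
move=> hB hI x xY; apply/eqP; rewrite eq_le maximum_principle //=.
rewrite -oppr_le0; apply: (maximum_principle (fun x => - h x)) => // y yY.
  by rewrite hB // oppr0.
by rewrite hI // -sumrN; apply: eq_bigr => z _; rewrite mulrN.
Qed.

(** A vector in the kernel, continued by zero to the boundary, is harmonic on the
interior. As the transition probabilities are real, its real and imaginary parts
are harmonic too. *)
Lemma interior_unitmx : 1%:M - PII \in unitmx.
Proof.
apply: unitmx_ker => v; rewrite mulmxBl mul1mx => /eqP.
rewrite subr_eq0 => /eqP vE.
have vB : {in bY, forall x, val_at v x = 0}.
  by move=> x xB; rewrite val_at_out // (disjointFl interior_boundary_disjoint).
have vI : {in iY, forall x,
    val_at v x = \sum_(y in Y) (p x y)%:C * val_at v y}.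
  move=> x xI; rewrite {1}vE val_at_mul // sum_network [X in _ + X]big1 ?addr0 //.
  by move=> y yB; rewrite vB // mulr0.
have ReM (c : R) (z : R[i]) : complex.Re (c%:C * z) = c * complex.Re z.
  by case: z => z1 z2 /=; rewrite mul0r subr0.
have ImM (c : R) (z : R[i]) : complex.Im (c%:C * z) = c * complex.Im z.
  by case: z => z1 z2 /=; rewrite mul0r addr0.
have Re0 : {in Y, forall x, complex.Re (val_at v x) = 0}.
  apply: harmonic_eq0 => x xY; first by rewrite vB.
  rewrite {1}vI // (big_morph (@complex.Re R) (id1 := 0) (op1 := +%R)) //.
    by apply: eq_bigr => y _; rewrite ReM.
  by move=> [? ?] [? ?].
have Im0 : {in Y, forall x, complex.Im (val_at v x) = 0}.
  apply: harmonic_eq0 => x xY; first by rewrite vB.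
  rewrite {1}vI // (big_morph (@complex.Im R) (id1 := 0) (op1 := +%R)) //.
    by apply: eq_bigr => y _; rewrite ImM.
  by move=> [? ?] [? ?].
apply: val_at_inj => x /(subsetP interior_sub) xY; rewrite val_at0.
by apply/eqP; rewrite eq_complex Re0 // Im0 //= eqxx.
Qed.

Lemma Smx_unit : 1%:M + Rmx E a Y \in unitmx -> Smx E a Y \in unitmx.
Proof. exact: schur_unitmx interior_unitmx. Qed.

(** * Reversible walks *)

Section Reversible.
Variable mu : X -> R.
Hypothesis mu_gt0 : {in Y, forall x, 0 < mu x}.
Hypothesis mu_sym : {in Y &, forall x y, mu x * p x y = mu y * p y x}.

Definition herm {A : {set X}} (v w : fun_on R A) : R[i] :=
  \sum_(x in A) (mu x)%:C * (val_at v x * (val_at w x)^*%C).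

Lemma herm_ge0 {A : {set X}} (v : fun_on R A) : A \subset Y -> 0 <= herm v v.
Proof.
move=> AY; apply: sumr_ge0 => x xA; rewrite mulr_ge0 ?mulcJ_ge0 // ler0c ltW //.
by rewrite mu_gt0 // (subsetP AY).
Qed.

Lemma herm_eq0 {A : {set X}} (v : fun_on R A) : A \subset Y -> herm v v = 0 -> v = 0.
Proof.
move=> AY v0; apply: val_at_inj => x xA; rewrite val_at0; apply/eqP.
have := psumr_eq0P _ v0 xA => /(_ _)/eqP.
rewrite !mulf_eq0 conjc_eq0 orbb fmorph_eq0 gt_eqF ?mu_gt0 ?(subsetP AY) //=.
apply=> y yA; rewrite mulr_ge0 ?mulcJ_ge0 // ler0c ltW //.
by rewrite mu_gt0 // (subsetP AY).
Qed.

Lemma hermDr {A : {set X}} (u v w : fun_on R A) : herm u (v + w) = herm u v + herm u w.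
Proof.
rewrite -big_split; apply: eq_bigr => x _.
by rewrite val_atD rmorphD !mulrDr.
Qed.

Lemma hermNr {A : {set X}} (u v : fun_on R A) : herm u (- v) = - herm u v.
Proof.
by rewrite -sumrN; apply: eq_bigr => x _; rewrite val_atN rmorphN !mulrN.
Qed.

Lemma hermNl {A : {set X}} (u v : fun_on R A) : herm (- u) v = - herm u v.
Proof.
by rewrite -sumrN; apply: eq_bigr => x _; rewrite val_atN mulNr !mulrN.
Qed.

Lemma hermDl {A : {set X}} (u v w : fun_on R A) : herm (u + v) w = herm u w + herm v w.
Proof.
rewrite -big_split; apply: eq_bigr => x _.
by rewrite val_atD mulrDl !mulrDr.
Qed.

(** Detailed balance makes the blocks from A to B and from B to A adjoint. *)
Lemma herm_adjoint {A B : {set X}} (v : fun_on R A) (w : fun_on R B) :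
  A \subset Y -> B \subset Y ->
  herm v (sub_block a Y A B *m w) = herm (sub_block a Y B A *m v) w.
Proof.
move=> AY BY.
have conjM (c : R) (z : R[i]) : (c%:C * z)^*%C = c%:C * z^*%C.
  by rewrite rmorphM [X in X * _]conjc_real.
have realM (b c : R) : (b * c)%:C = b%:C * c%:C by rewrite rmorphM.
transitivity (\sum_(x in A) \sum_(y in B)
    (mu x * p x y)%:C * (val_at v x * (val_at w y)^*%C)).
  apply: eq_bigr => x xA; rewrite val_at_mul // rmorph_sum !mulr_sumr.
  apply: eq_bigr => y yB; rewrite [X in _ * (_ * X)]conjM realM.
  by rewrite -mulrA; congr (_ * _); rewrite mulrCA.
rewrite exchange_big; apply: eq_bigr => y yB.
rewrite val_at_mul // mulr_suml mulr_sumr; apply: eq_bigr => x xA.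
by rewrite mu_sym ?(subsetP AY x) ?(subsetP BY y) // realM !mulrA.
Qed.

(** With w = (1 - P)^-1 C v and z = (1 - P)^-1 w, the vector R v is B z, and
<v, B z> = <C v, z> = <(1 - P) w, z> = <w, (1 - P) z> = <w, w>. *)
Lemma Rmx_unit : 1%:M + Rmx E a Y \in unitmx.
Proof.
apply: unitmx_ker => v; rewrite mulmxDl mul1mx -!mulmxA.
set w := green E a Y *m (PIB *m v); set z := green E a Y *m w => vE.
have wE : PIB *m v = w - PII *m w.
  by rewrite -{1}[w]mul1mx -mulmxBl mulKVmx // interior_unitmx.
have zE : z - PII *m z = w.
  by rewrite -{1}[z]mul1mx -mulmxBl mulKVmx // interior_unitmx.
have PBIz : herm v (PBI *m z) = herm w w.
  rewrite herm_adjoint ?interior_sub ?boundary_sub // wE hermDl hermNl.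
  by rewrite -herm_adjoint ?interior_sub // -hermNr -hermDr zE.
have vw0 : herm v v + herm w w = 0.
  rewrite -PBIz -hermDr vE; apply: big1 => x _.
  by rewrite val_at0 conjc0 !mulr0.
apply: herm_eq0; first exact: boundary_sub.
apply/eqP; move/eqP: vw0.
rewrite paddr_eq0 ?herm_ge0 ?interior_sub ?boundary_sub //.
by case/andP.
Qed.

End Reversible.

(** The measure pi m_Y / m satisfies detailed balance for the walk on Y, because
multiplying it by a / m_Y gives back pi a / m. *)
Lemma reversible_Rmx_unit :
  strongly_connected E -> reversible a -> 1%:M + Rmx E a Y \in unitmx.
Proof.
move=> E_connected [pi pi_st pi_rev].
have w_gt0 x : x \in Y -> 0 < weight a x.
  move=> /sub_weight_gt0 xw; apply: lt_le_trans xw _.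
  rewrite /weight (bigID (mem Y)) /= lerDl.
  by apply: sumr_ge0 => *; apply: (a_ge0 a_pos a_zero).
apply: (@Rmx_unit (fun x => pi x * sub_weight a Y x / weight a x)).
  move=> x xY; rewrite divr_gt0 ?mulr_gt0 ?sub_weight_gt0 ?w_gt0 //.
  exact: (stationary_gt0 a_pos a_zero _ E_connected pi_st).
suff muE x y : x \in Y ->
    pi x * sub_weight a Y x / weight a x * p x y = pi x * trans a x y.
  by move=> x y xY yY; rewrite !muE.
move=> xY; rewrite /sub_trans /trans -!mulrA; congr (_ * _).
rewrite mulrCA [RHS]mulrC; congr (_ * _).
by rewrite mulrCA divff ?mulr1 // gt_eqF ?sub_weight_gt0.
Qed.

End Network.

(** * From the mixed problem to the Dirichlet problem *)

Section Mixed.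
Context {R : realType} {X : finType} {E : rel X} {a : X -> X -> R}.
Context {dX : {set X}}.
Hypothesis E_connected : strongly_connected E.
Hypothesis a_pos : forall x y, E x y -> 0 < a x y.
Hypothesis a_zero : forall x y, ~~ E x y -> a x y = 0.
Local Notation Y := (~: dX).
Local Notation bY := (net_boundary E Y).

(** A path from x to a vertex of dX has to leave Y. *)
Lemma boundary_neq0 x : dX != set0 -> x \in Y -> bY != set0.
Proof.
move=> /set0Pn [z zX] xY; apply: contraTneq zX => bY0; rewrite -in_setC.
apply: (@connect_closed _ _ (mem Y) _ _ (E_connected x z) xY) => y w /= yY yw.
apply: contraT => wY; have : y \in bY; last by rewrite bY0 inE.
by rewrite in_set yY; apply/existsP; exists w; rewrite wY.
Qed.

Lemma trans_set_gt0 y : y \in bY -> 0 < trans_set a y dX.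
Proof.
rewrite in_set => /andP [_ /existsP [z /andP [zX yz]]].
rewrite in_setC negbK in zX.
rewrite /trans_set (bigD1 z) //= ltr_wpDr //.
  by apply: sumr_ge0 => *; apply: (trans_ge0 a_pos a_zero).
exact: (trans_gt0 a_pos a_zero).
Qed.

(** On the boundary of Y the conormal derivative of u is the mean of g2 over the
neighbours in dX minus u, and the Dirichlet datum is the same mean minus g1. *)
Lemma conormalE (g1 : fun_on R bY) (g2 : fun_on R dX) (u : fun_on R [set: X]) :
  restr_to dX u = g2 ->
  conormal E a Y u = g1 <->
  restr_to bY (restr_to Y u) = dirichlet_data a g1 g2.
Proof.
move=> uE; set g := dirichlet_data a g1 g2.
have key : {in bY, forall y,
    val_at (conormal E a Y u) y - val_at g1 y = val_at g y - val_at u y}.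
  move=> y yB; rewrite (val_at_col (fun y => ((trans_set a y (~: Y))%:C)^-1 *
    \sum_(z in ~: Y) (trans a y z)%:C * (val_at u z - val_at u y))) //.
  rewrite (val_at_col (fun y => ((trans_set a y dX)%:C)^-1 *
    (\sum_(z in dX) (trans a y z)%:C * val_at g2 z) - val_at g1 y)) //.
  rewrite setCK [RHS]addrAC; congr (_ - _).
  under eq_bigr do rewrite mulrBr.
  rewrite sumrB -mulr_suml -rmorph_sum /= -/(trans_set a y dX) mulrBr mulKf.
    congr (_ * _ - _); apply: eq_bigr => z zX.
    by rewrite -uE val_at_restr.
  by rewrite fmorph_eq0 gt_eqF // trans_set_gt0.
split=> h; apply: val_at_inj => y yB; have := key y yB;
  have yY := subsetP boundary_sub _ yB.
  rewrite h subrr => /esym/eqP; rewrite subr_eq0 => /eqP ->.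
  by rewrite !val_at_restr //.
have -> : val_at g y = val_at u y.
  by rewrite -h !val_at_restr //.
by rewrite subrr => /eqP; rewrite subr_eq0 => /eqP.
Qed.

Lemma mixed_problemE (f : fun_on R (net_interior E Y)) (g1 : fun_on R bY)
    (g2 : fun_on R dX) (u : fun_on R [set: X]) :
  mixed_problem a f g1 g2 u <->
  dirichlet_problem a f (dirichlet_data a g1 g2) (restr_to Y u) /\
  restr_to dX u = g2.
Proof.
split=> [[uf ug1 ug2] | [[uf ug] ug2]].
  by split=> //; split=> //; apply/(conormalE _ _ _ ug2).
by split=> //; apply/(conormalE _ _ _ ug2).
Qed.

End Mixed.

Theorem mainTheorem9 (R : realType) (X : finType) (E : rel X)
    (a : X -> X -> R) (dX : {set X})
    (E_loopless : forall x, ~~ E x x)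
    (E_connected : strongly_connected E)
    (a_pos : forall x y, E x y -> 0 < a x y)
    (a_zero : forall x y, ~~ E x y -> a x y = 0)
    (dX_nonempty : dX != set0)
    (Y_card : (2 <= #|~: dX|)%N)
    (Y_connected : induced_strongly_connected E (~: dX))
    (f : fun_on R (net_interior E (~: dX)))
    (g1 : fun_on R (net_boundary E (~: dX)))
    (g2 : fun_on R dX) :
  (reversible a -> 1%:M + Rmx E a (~: dX) \in unitmx) /\
  (1%:M + Rmx E a (~: dX) \in unitmx ->
    exists u : fun_on R [set: X],
      let g := dirichlet_data a g1 g2 in
      [/\ unique (mixed_problem a f g1 g2) u,
          unique (dirichlet_problem a f g) (restr_to (~: dX) u),
          Smx E a (~: dX) \in unitmx &
          restr_to (net_interior E (~: dX)) u =
            invmx (Smx E a (~: dX)) *m (f + Umx E a (~: dX) *m g)]).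
Proof.
have [x xY] : exists x, x \in ~: dX by apply/set0Pn; rewrite -card_gt0 ltnW.
have bY_n0 := boundary_neq0 E_connected _ dX_nonempty xY.
split=> [|uR]; first exact: reversible_Rmx_unit.
have uS := Smx_unit a_pos a_zero Y_connected Y_card bY_n0 uR.
set g := dirichlet_data a g1 g2.
pose w := invmx (Smx E a (~: dX)) *m (f + Umx E a (~: dX) *m g).
pose v : fun_on R (~: dX) := glue (~: dX) w g.
have vI : restr_to (net_interior E (~: dX)) v = w.
  exact: restr_gluel interior_sub interior_boundary_disjoint.
have vB : restr_to (net_boundary E (~: dX)) v = g.
  exact: restr_gluer boundary_sub interior_boundary_disjoint.
have v_uniq : unique (dirichlet_problem a f g) v.
  split=> [|v' /(dirichlet_problemE _ _ _ uS) [v'I v'B]].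
    exact/(dirichlet_problemE _ _ _ uS).
  apply: (restr_inj _ _ (interior_boundary_cover (E := E))).
    by rewrite vI v'I.
  by rewrite vB v'B.
pose u : fun_on R [set: X] := glue [set: X] v g2.
have dis : [disjoint ~: dX & dX] by rewrite disjoints_subset.
have uY : restr_to (~: dX) u = v by apply: restr_gluel; rewrite ?subsetT.
have udX : restr_to dX u = g2 by apply: restr_gluer; rewrite ?subsetT.
exists u => /=; rewrite uY; split => //.
- split=> [|u' /(mixed_problemE a_pos a_zero) [u'Y u'dX]].
    by apply/(mixed_problemE a_pos a_zero); rewrite uY; split=> //; case: v_uniq.
  apply: (@restr_inj _ _ (~: dX) dX); first by rewrite setUC setUCr.
    by rewrite uY; apply: (proj2 v_uniq).
  by rewrite udX.
- rewrite -/w -vI -uY; apply: val_at_inj => y yI; rewrite !val_at_restr //.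
  exact: subsetP interior_sub _ yI.
Qed.
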